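(* Let $n\ge 1$ and let $k_1<k_2<\cdots<k_n$ be integers. Then the number of monotone triangles with $n$ rows and bottom row $(k_1,k_2,\ldots,k_n)$ is equal to the value at $(x_1,\ldots,x_n)=(k_1,\ldots,k_n)$ of the polynomial $$\left( \prod_{1 \le p < q \le n} \left( \operatorname{id} + E_{x_p} \Delta_{x_q} \right) \right) \prod_{1 \le i < j \le n} \frac{x_j - x_i}{j-i}.$$
   Context: A monotone triangle with $n$ rows is a triangular array $(a_{i,j})_{1\le j\le i\le n}$ of integers such that $a_{i,j}\le a_{i-1,j}\le a_{i,j+1}$ and $a_{i,j}<a_{i,j+1}$ whenever the indices are in range; its bottom row is $(a_{n,1},\ldots,a_{n,n})$. For a variable $x$, $E_x$ is the shift operator on polynomials, $E_x\,p(x)=p(x+1)$ (other variables fixed), and $\Delta_x=E_x-\operatorname{id}$ is the difference operator. Products of operators denote composition; the operators $E_{x_p},\Delta_{x_q}$ all commute, so the order of the factors is irrelevant. The operator is applied to the polynomial in $x_1,\ldots,x_n$ and the result is then evaluated at $x_i=k_i$. *)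

(* Defs.v *)
From mathcomp Require Import all_boot all_order all_algebra.
Set Implicit Arguments. Unset Strict Implicit. Unset Printing Implicit Defensive.
Import Order.TTheory GRing.Theory Num.Theory.
Local Open Scope ring_scope.

(* A monotone triangle with n rows is encoded as a list of n rows;
   row r (0-indexed) has r+1 entries: t`_r`_c = a_{r+1,c+1}. *)
Definition entry (t : seq (seq int)) (r c : nat) : int := nth 0 (nth [::] t r) c.

Definition monotone_triangle (n : nat) (t : seq (seq int)) : Prop :=
  size t = n /\
  (forall r, (r < n)%N -> size (nth [::] t r) = r.+1) /\
  (forall r c, (r.+1 < n)%N -> (c <= r)%N ->
      entry t r.+1 c <= entry t r c /\ entry t r c <= entry t r.+1 c.+1) /\
  (forall r c, (r < n)%N -> (c < r)%N -> entry t r c < entry t r c.+1).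

Definition bottom_row (n : nat) (t : seq (seq int)) : seq int := nth [::] t n.-1.

(* Functions of n rational variables x_0, ..., x_{n-1}; polynomials are
   viewed as such functions (the operators below are finite combinations
   of shifts, so applying them to a polynomial and evaluating commutes
   with viewing the polynomial as a function). *)
Definition fn (n : nat) := ('I_n -> rat) -> rat.

Definition shiftv (n : nat) (p : 'I_n) (x : 'I_n -> rat) : 'I_n -> rat :=
  fun i => if i == p then x i + 1 else x i.

Definition Eop (n : nat) (p : 'I_n) (f : fn n) : fn n := fun x => f (shiftv p x).

Definition Dop (n : nat) (q : 'I_n) (f : fn n) : fn n := fun x => Eop q f x - f x.

Definition idEDop (n : nat) (p q : 'I_n) (f : fn n) : fn n :=
  fun x => f x + Eop p (Dop q f) x.

Definition pairs_lt (n : nat) : seq ('I_n * 'I_n) :=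
  [seq pq : 'I_n * 'I_n <- [seq (p, q) | p <- enum 'I_n, q <- enum 'I_n] | (nat_of_ord pq.1 < nat_of_ord pq.2)%N].

Definition big_op (n : nat) (f : fn n) : fn n :=
  foldr (fun pq g => idEDop pq.1 pq.2 g) f (pairs_lt n).

(* prod_{1 <= i < j <= n} (x_j - x_i)/(j - i)  (0-indexed; j - i unchanged) *)
Definition vdm_quot (n : nat) : fn n :=
  fun x => \prod_(i < n) \prod_(j < n | (i < j)%N) ((x j - x i) / (j - i)%:R).

(* Main.v *)
Require Import Defs.
From mathcomp Require Import all_boot all_order all_algebra.
From mathcomp Require Import all_fingroup zify ring lra.
From Stdlib Require Import FunctionalExtensionality.
Import Order.TTheory GRing.Theory Num.Theory.
Local Open Scope ring_scope.
Set Implicit Arguments. Unset Strict Implicit. Unset Printing Implicit Defensive.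

(* Let W be the operator product and B = W det [binom(x_i, j+1)] in m variables,
   so that applying every Delta_i to B gives the claimed formula alpha_m. Since
   (1 + E_(i+1) Delta_i) B is antisymmetric in x_i and x_(i+1), it vanishes when
   x_i = x_(i+1); this says B(y,y) + B(y+1,y+1) = B(y,y+1) in these two slots.
   Summing alpha_m over the rows above k telescopes one variable at a time, and
   the three-term identity collapses the boundary terms to
     sum_r (-1)^r B(k_0, .., k_(r-1), k_(r+1) + 1, .., k_m + 1).
   This is also W det [binom(k_i, j)] in m+1 variables: expand the determinant
   along its column of ones; on a minor independent of x_r, Delta_r acts as 0 and
   E_r as the identity, so W acts as (prod_(q > r) E_q) times the smaller W. *)

(** * Enumeration of the rows that interlace a given row *)

Definition int_range (a b : int) : seq int :=
  [seq a + i%:Z | i <- iota 0 `|b - a|%N].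

Lemma mem_int_range (a b x : int) :
  a <= b -> (x \in int_range a b) = (a <= x < b).
Proof.
move=> ab; apply/mapP/idP => [[i]|xab].
  by rewrite mem_iota => /andP[_ ib] ->; lia.
exists `|x - a|%N; last by lia.
by rewrite mem_iota; lia.
Qed.

Lemma int_range_uniq (a b : int) : uniq (int_range a b).
Proof. by rewrite map_inj_uniq ?iota_uniq // => i j /addrI []. Qed.

Lemma telescope_int_range (V : zmodType) (f : int -> V) (a b : int) :
  a <= b -> \sum_(x <- int_range a b) (f (x + 1) - f x) = f b - f a.
Proof.
move=> ab; rewrite big_map -{1}[`|b - a|%N]subn0 -/(index_iota _ _).
rewrite (telescope_sumr_eq (fun i : nat => f (a + i%:Z))) //.
  by rewrite addr0; congr (f _ - _); lia.
by move=> i _; congr (f _ - _); lia.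
Qed.

(* Once an entry equals its upper bound [b], the next one must start from
   [b + 1] because rows are strictly increasing. *)
Fixpoint rows (a : int) (s : seq int) : seq (seq int) :=
  if s is b :: s' then
    [seq x :: l | x <- int_range a b, l <- rows b s'] ++
    [seq b :: l | l <- rows (b + 1) s']
  else [:: [::]].

(** The lower bound [a] of the first entry is kept apart from [s], because the recursion of [rows]
    may raise it from an entry [b] of the row below to [b + 1]. *)
Definition interlaced (a : int) (s l : seq int) : Prop :=
  [/\ size l = size s, sorted <%R l &
      forall c, (c < size s)%N -> nth 0 (a :: s) c <= nth 0 l c <= nth 0 s c].

Lemma rowsP (a : int) (s l : seq int) :
  a <= head a s -> sorted <%R s -> l \in rows a s <-> interlaced a s l.
Proof.
elim: s a l => [|b s IH] a l /=.
  move=> _ _; rewrite inE; split=> [/eqP->|[/size0nil->]]//.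
move=> ab bs.
have bs1 : b <= head b s by case: s bs {IH} => //= c s /andP[/ltW].
have bs2 : b + 1 <= head (b + 1) s by case: s bs {IH bs1} => //= c s /andP[]; lia.
have ss := path_sorted bs.
rewrite mem_cat; split.
  case/orP=> [/allpairsPdep[x [l' [xab l'b ->]]]|/mapP[l' l'b ->]].
    move: xab l'b; rewrite mem_int_range// => xab /(IH _ _ bs1 ss)[sz sl hl].
    split=> /=; first by rewrite sz.
      case: l' sz sl hl => //= y l' sz -> hl; rewrite andbT.
      by case: s sz hl {IH bs bs1 bs2 ss} => //= c s _ /(_ 0 isT) /=; lia.
    case=> [_ /=|c]; first by lia.
    by move=> /hl.
  move: l'b => /(IH _ _ bs2 ss)[sz sl hl].
  split=> /=; first by rewrite sz.
    case: l' sz sl hl => //= y l' sz -> hl; rewrite andbT.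
    by case: s sz hl {IH bs bs1 bs2 ss} => //= c s _ /(_ 0 isT) /=; lia.
  case=> [_ /=|c]; first by lia.
  by rewrite ltnS => /hl; case: c => [|c] /=; lia.
case: l => [[]//|x l [/= [sz] sl hl]].
have /= x0 := hl 0 isT.
have hl' c : (c < size s)%N -> nth 0 (b :: s) c <= nth 0 l c <= nth 0 s c.
  by move=> cs; exact: (hl c.+1).
(* If [x < b], strictness before the next entry is automatic, as that entry is at least [b]; if
   [x = b], it amounts to the raised bound [b + 1]. *)
case: (ltP x b) => xb.
  apply/orP; left; apply/allpairsPdep; exists x, l; split=> //.
    by rewrite mem_int_range//; lia.
  by apply/(IH _ _ bs1 ss); split=> //; exact: path_sorted sl.
have {xb x0} xb : x = b by lia.
apply/orP; right; apply/mapP; exists l; last by rewrite xb.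
apply/(IH _ _ bs2 ss); split=> //; first exact: path_sorted sl.
case=> [|c] cs; last exact: hl'.
have := hl' 0 cs; case: l sl sz {hl hl'} cs => [|y l] /=; first by case: s {IH bs bs1 bs2 ss}.
by move=> /andP[xy _] _ _ /andP[_ ys]; rewrite lezD1 -xb xy.
Qed.

Lemma rows_uniq (a : int) (s : seq int) :
  a <= head a s -> sorted <%R s -> uniq (rows a s).
Proof.
elim: s a => [|b s IH] a //= ab bs.
have bs1 : b <= head b s by case: s bs {IH} => //= c s /andP[/ltW].
have bs2 : b + 1 <= head (b + 1) s by case: s bs {IH bs1} => //= c s /andP[]; lia.
have ss := path_sorted bs.
rewrite cat_uniq map_inj_uniq ?IH//; last by move=> ? ? [].
rewrite allpairs_uniq ?IH ?int_range_uniq//=; last by move=> [? ?] [? ?] _ _ [-> ->].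
(* The two sublists are disjoint: heads in the first are strictly below [b], heads in the second
   equal [b]. *)
rewrite andbT; apply/hasPn => l /mapP[l' _ ->]; apply/negP.
by case/allpairsPdep=> [x [l2 [xab _ [bx _]]]]; move: xab; rewrite mem_int_range// -bx; lia.
Qed.

(** * Telescoping of sums over interlacing rows *)

Fixpoint delta_all (B : seq int -> rat) (l : seq int) : rat :=
  if l is a :: l' then
    delta_all (fun m => B (a + 1 :: m)) l' - delta_all (fun m => B (a :: m)) l'
  else B [::].

(** The alternating boundary sum left by the telescoping, in a recursive form that follows [rows];
    [altsumE] gives the closed form. *)
Fixpoint altsum (s : seq int) (B : seq int -> rat) : rat :=
  if s is a :: s' then
    B [seq x + 1 | x <- s'] - altsum s' (fun l => B (a :: l))
  else 0.

Lemma altsum_add (s : seq int) (B1 B2 B3 : seq int -> rat) :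
  (forall l, size l = (size s).-1 -> B1 l + B2 l = B3 l) ->
  altsum s B1 + altsum s B2 = altsum s B3.
Proof.
elim: s B1 B2 B3 => [|a s IH] B1 B2 B3 h /=; first by rewrite addr0.
rewrite -h ?size_map//.
(* A singleton is treated apart: the truncated [(size s).-1] is 0 for the empty tail too, so [h]
   would not supply what [IH] asks there. *)
case: s IH h => [|b s] IH h; first by rewrite /= !subr0.
rewrite -(IH (fun l => B1 (a :: l)) (fun l => B2 (a :: l))
  (fun l => B3 (a :: l))); first by ring.
by move=> l /= sz; apply: h; rewrite /= sz.
Qed.

(* Expresses that [id + E_(i+1) Delta_i] applied to [B] vanishes
   whenever the arguments [i] and [i+1] coincide. *)
Definition three_term (m : nat) (B : seq int -> rat) : Prop :=
  forall u y v, size (u ++ [:: y, y & v]) = m ->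
    B (u ++ [:: y, y & v]) + B (u ++ [:: y + 1, y + 1 & v]) =
    B (u ++ [:: y, y + 1 & v]).

Lemma three_term_cons (m : nat) (B : seq int -> rat) (a : int) :
  three_term m.+1 B -> three_term m (fun l => B (a :: l)).
Proof. by move=> h u y v sz; apply: (h (a :: u)); rewrite /= sz. Qed.

(** Induction evaluates the sum over the tail for each fixed head. Heads below [b] then telescope
    from [a] to [b], and the head [b] adds one more difference, with tails starting from [b + 1]. *)
Lemma sum_rows (a : int) (s : seq int) (B : seq int -> rat) :
  a <= head a s -> sorted <%R s -> three_term (size s) B ->
  \sum_(l <- rows a s) delta_all B l = altsum (a :: s) B.
Proof.
elim: s a B => [|b s IH] a B ab /=.
  by move=> _ _; rewrite big_seq1 subr0.
move: ab => /= ab bs hB.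
have bs1 : b <= head b s by case: s bs {IH hB} => //= c s /andP[/ltW].
have bs2 : b + 1 <= head (b + 1) s.
  by case: s bs {IH hB bs1} => //= c s /andP[]; lia.
have ss := path_sorted bs.
rewrite big_cat big_map big_allpairs_dep /=.
have S1 x : \sum_(l <- rows b s) delta_all B (x :: l) =
    altsum (b :: s) (fun l => B (x + 1 :: l)) - altsum (b :: s) (fun l => B (x :: l)).
  by rewrite -!IH ?sumrB//; exact: three_term_cons.
under eq_bigr => x _ do rewrite S1.
rewrite (telescope_int_range (fun x => altsum (b :: s) (fun l => B (x :: l))))//.
rewrite sumrB !IH//; try exact: three_term_cons.
(* After cancellation only the terms with equal or consecutive first two arguments remain: the
   three-term identity with empty prefix, under [altsum s]. *)
suff H : altsum s (fun l => B [:: b, b & l]) +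
         altsum s (fun l => B [:: b + 1, b + 1 & l]) =
         altsum s (fun l => B [:: b, b + 1 & l]) by rewrite /= -H; ring.
case: s {IH ab bs bs1 bs2 ss S1} hB => [|c s] hB; first by rewrite addr0.
by apply: altsum_add => l sz; apply: (hB [::] b l); rewrite /= sz.
Qed.

Lemma altsumE (s : seq int) (B : seq int -> rat) :
  altsum s B = \sum_(r < size s)
    (-1) ^+ r * B (take r s ++ [seq x + 1 | x <- drop r.+1 s]).
Proof.
elim: s B => [|a s IH] B; first by rewrite big_ord0.
rewrite big_ord_recl /= drop0 expr0 mul1r IH -sumrN; congr (_ + _).
by apply: eq_bigr => i _; rewrite exprS mulN1r mulNr.
Qed.

(** * Enumeration of monotone triangles by their bottom row *)

Definition rows_above (k : seq int) : seq (seq int) := rows (head 0 k) (behead k).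

Fixpoint triangles (n : nat) (k : seq int) : seq (seq (seq int)) :=
  if n is n'.+1 then
    [seq rcons t k | l <- rows_above k, t <- triangles n' l]
  else [:: [::]].

Lemma rows_aboveP (n : nat) (k l : seq int) :
  size k = n.+1 -> sorted <%R k ->
  l \in rows_above k <-> [/\ size l = n, sorted <%R l &
    forall c, (c < n)%N -> nth 0 k c <= nth 0 l c <= nth 0 k c.+1].
Proof.
case: k => [//|a s] [sz] /= srt; rewrite /rows_above /=.
have ha : a <= head a s by case: s srt {sz} => //= b s /andP[/ltW].
by rewrite (rowsP l ha (path_sorted srt)) /interlaced sz.
Qed.

Lemma trianglesP (n : nat) (k : seq int) (t : seq (seq int)) :
  size k = n -> sorted <%R k ->
  t \in triangles n k <-> monotone_triangle n t /\ bottom_row n t = k.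
Proof.
elim: n k t => [|n IH] k t szk srt /=.
  rewrite inE; split=> [/eqP->|[[/size0nil-> _] _]]//; split; first by [].
  by move/size0nil: szk.
split.
  case/allpairsPdep=> [l [t' [lk tl ->]]].
  move: lk => /(rows_aboveP l szk srt)[szl sl hl].
  move: tl => /(IH _ _ szl sl)[[st [h1 [h2 h3]]] hb].
  have nt r : nth [::] (rcons t' k) r =
      if (r < n)%N then nth [::] t' r else if r == n then k else [::].
    by rewrite nth_rcons st.
  split; last by rewrite /bottom_row /= nt ltnn eqxx.
  split; first by rewrite size_rcons st.
  split=> [r|]; first rewrite ltnS leq_eqVlt => /orP[/eqP->|rn].
  - by rewrite nt ltnn eqxx.
  - by rewrite nt rn h1.
  split=> r c; rewrite ltnS leq_eqVlt => /orP[/eqP rn|rn] cr; rewrite /entry !nt.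
  - have -> : (r.+1 < n)%N = false by lia.
      have -> : (r < n)%N by lia.
      rewrite rn eqxx.
      have -> : nth [::] t' r = l by rewrite -hb /bottom_row -rn.
      by have /andP[] := hl c (leq_ltn_trans cr (eq_leq rn)).
  - by rewrite rn (ltnW rn); exact: h2.
  - by rewrite rn ltnn eqxx; apply: (sortedP 0 srt); rewrite szk -rn.
  - by rewrite rn; exact: h3.
move=> [[st [h1 [h2 h3]]] hb].
case/lastP: t st h1 h2 h3 hb => [//|t' k'].
rewrite size_rcons => -[st] h1 h2 h3.
have nt r : nth [::] (rcons t' k') r =
      if (r < n)%N then nth [::] t' r else if r == n then k' else [::].
  by rewrite nth_rcons st.
rewrite /bottom_row /= nt ltnn eqxx => kk; subst k'.
(* The row above [k] is the last row of [t']; for [n = 0] it is the default [[::]], which is the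
   only row above a singleton. *)
apply/allpairsPdep; exists (nth [::] t' n.-1), t'.
have mt : monotone_triangle n t'.
  split=> //; split=> [r rn|]; first by have := h1 r (ltnW rn); rewrite nt rn.
  split=> r c rn cr.
    by have := h2 r c (ltnW rn) cr; rewrite /entry !nt rn (ltnW rn).
  by have := h3 r c (ltnW rn) cr; rewrite /entry !nt rn.
have szl : size (nth [::] t' n.-1) = n.
  case: n st mt {IH szk h1 h2 h3 nt} => [/size0nil->//|n] _ [_ [h1 _]].
  exact: h1.
have sl : sorted <%R (nth [::] t' n.-1).
  apply/(sortedP 0) => i; rewrite szl => i1.
  case: mt => _ [_ [_ h]]; apply: (h n.-1 i); lia.
split=> //; last exact/IH.
apply/(rows_aboveP _ szk srt); split=> // c cn.
have n1 : n.-1.+1 = n by lia.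
have := h2 n.-1 c; rewrite /entry !nt n1 ltnS leqnn ltnn eqxx.
by move=> /(_ isT) h; have [|-> ->] := h; first lia.
Qed.

Lemma triangles_uniq (n : nat) (k : seq int) :
  size k = n -> sorted <%R k -> uniq (triangles n k).
Proof.
elim: n k => [|n IH] k szk srt //=.
apply: allpairs_uniq_dep.
- case: k szk srt => [//|a s] _ /= srt; rewrite /rows_above /= rows_uniq ?(path_sorted srt)//.
  by case: s srt => //= b s /andP[/ltW].
- by move=> l /(rows_aboveP l szk srt)[szl sl _]; exact: IH.
move=> p q.
case/allpairsPdep=> [l1 [t1 [lk1 tl1 ->]]].
case/allpairsPdep=> [l2 [t2 [lk2 tl2 ->]]] /=.
(* The chosen row [l] can be recovered from the triangle, as the bottom row of its upper part. *)
move=> /rcons_inj[t12]; move: tl1 tl2; rewrite -t12.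
move: lk1 lk2 => /(rows_aboveP _ szk srt)[szl1 sl1 _] /(rows_aboveP _ szk srt)[szl2 sl2 _].
by move=> /(trianglesP _ szl1 sl1)[_ <-] /(trianglesP _ szl2 sl2)[_ <-].
Qed.

(** * Commutation of the operators *)

Lemma shiftvC (n : nat) (p q : 'I_n) (x : 'I_n -> rat) :
  shiftv p (shiftv q x) = shiftv q (shiftv p x).
Proof.
apply: functional_extensionality => i; rewrite /shiftv.
by case: (i == p); case: (i == q).
Qed.

Lemma idEDopC (n : nat) (p q r s : 'I_n) (f : fn n) :
  idEDop p q (idEDop r s f) = idEDop r s (idEDop p q f).
Proof.
apply: functional_extensionality => x; rewrite /idEDop /Eop /Dop /Eop.
by rewrite !(shiftvC r q) !(shiftvC r p) !(shiftvC s q) !(shiftvC s p); ring.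
Qed.

Lemma idEDop_Dop (n : nat) (p q r : 'I_n) (f : fn n) :
  idEDop p q (Dop r f) = Dop r (idEDop p q f).
Proof.
apply: functional_extensionality => x; rewrite /idEDop /Eop /Dop /Eop.
by rewrite !(shiftvC r q) !(shiftvC r p); ring.
Qed.

(** [big_op] over an arbitrary list of pairs, so that factors can be added, removed and permuted. *)
Definition idEDops (n : nat) (s : seq ('I_n * 'I_n)) (f : fn n) : fn n :=
  foldr (fun pq g => idEDop pq.1 pq.2 g) f s.

Lemma idEDops_cat (n : nat) (s1 s2 : seq ('I_n * 'I_n)) (f : fn n) :
  idEDops (s1 ++ s2) f = idEDops s1 (idEDops s2 f).
Proof. exact: foldr_cat. Qed.

Lemma idEDop_idEDops (n : nat) (p q : 'I_n) (s : seq ('I_n * 'I_n)) (f : fn n) :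
  idEDop p q (idEDops s f) = idEDops s (idEDop p q f).
Proof. by elim: s => //= pq s IH; rewrite idEDopC IH. Qed.

Lemma idEDopsC (n : nat) (s1 s2 : seq ('I_n * 'I_n)) (f : fn n) :
  idEDops s1 (idEDops s2 f) = idEDops s2 (idEDops s1 f).
Proof. by elim: s1 => //= pq s IH; rewrite IH idEDop_idEDops. Qed.

Lemma idEDops_perm (n : nat) (s1 s2 : seq ('I_n * 'I_n)) (f : fn n) :
  perm_eq s1 s2 -> idEDops s1 f = idEDops s2 f.
Proof.
move=> h; apply: (catCA_perm_ind _ h (P := fun s => idEDops s1 f = idEDops s f)) => //.
by move=> u v w ->; rewrite !idEDops_cat idEDopsC.
Qed.

Lemma idEDops_Dop (n : nat) (s : seq ('I_n * 'I_n)) (r : 'I_n) (f : fn n) :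
  idEDops s (Dop r f) = Dop r (idEDops s f).
Proof. by elim: s => //= pq s ->; rewrite idEDop_Dop. Qed.

Lemma idEDops_sum (n m : nat) (s : seq ('I_n * 'I_n)) (c : 'I_m -> rat)
    (f : 'I_m -> fn n) (x : 'I_n -> rat) :
  idEDops s (fun y => \sum_(i < m) c i * f i y) x =
  \sum_(i < m) c i * idEDops s (f i) x.
Proof.
elim: s x => //= pq s IH x; rewrite /idEDop /Eop /Dop /Eop !IH.
rewrite -sumrB -big_split; apply: eq_bigr => i _ /=; ring.
Qed.

Lemma mem_pairs_lt (n : nat) (p q : 'I_n) : ((p, q) \in pairs_lt n) = (p < q)%N.
Proof.
rewrite mem_filter /=; case: ltnP => //= _.
by apply/allpairsP; exists (p, q); rewrite !mem_enum.
Qed.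

Lemma pairs_lt_uniq (n : nat) : uniq (pairs_lt n).
Proof.
by rewrite filter_uniq// allpairs_uniq ?enum_uniq// => -[? ?] [? ?] _ _ [-> ->].
Qed.

(** * Antisymmetry and the three-term identity *)

Definition swapv (n : nat) (a b : 'I_n) (x : 'I_n -> rat) : 'I_n -> rat :=
  fun i => x (tperm a b i).

Definition swap_pair (n : nat) (a b : 'I_n) (pq : 'I_n * 'I_n) : 'I_n * 'I_n :=
  (tperm a b pq.1, tperm a b pq.2).

Lemma shiftv_swapv (n : nat) (a b p : 'I_n) (x : 'I_n -> rat) :
  shiftv p (swapv a b x) = swapv a b (shiftv (tperm a b p) x).
Proof.
apply: functional_extensionality => i.
by rewrite /swapv /shiftv (inj_eq perm_inj).
Qed.

(** Conjugation by a transposition of variables relabels the operators; the sign comes from the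
    antisymmetry of [f]. *)
Lemma idEDops_swapv (n : nat) (a b : 'I_n) (s : seq ('I_n * 'I_n)) (f : fn n)
    (x : 'I_n -> rat) :
  (forall y, f (swapv a b y) = - f y) ->
  idEDops s f (swapv a b x) = - idEDops [seq swap_pair a b pq | pq <- s] f x.
Proof.
move=> hf; elim: s x => [|pq s IH] x /=; first exact: hf.
by rewrite /idEDop /Eop /Dop /Eop !shiftv_swapv !IH; ring.
Qed.

(** Exchanging neighbours reverses the order of no pair except [(a, b)], so adjoining [(b, a)] makes
    the set of pairs stable. *)
Lemma pairs_lt_swap (n : nat) (a b : 'I_n) :
  b = a.+1 :> nat ->
  perm_eq ((b, a) :: pairs_lt n) [seq swap_pair a b pq | pq <- (b, a) :: pairs_lt n].
Proof.
move=> ab.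
have ba : (b < a)%N = false by lia.
have ulist : uniq ((b, a) :: pairs_lt n).
  by rewrite /= mem_pairs_lt ba pairs_lt_uniq.
have sK : involutive (@swap_pair n a b).
  by move=> [p q]; rewrite /swap_pair /= !tpermK.
apply: uniq_perm => //; first by rewrite (map_inj_uniq (inv_inj sK)).
move=> pq; rewrite -{2}[pq]sK (mem_map (inv_inj sK)).
case: pq => p q; rewrite /swap_pair !inE !mem_pairs_lt /=.
rewrite /swap_pair !xpair_eqE.
have [[pa pb] [qa qb]] : ((p == a) = (p == a :> nat) /\ (p == b) = (p == b :> nat)) /\
  ((q == a) = (q == a :> nat) /\ (q == b) = (q == b :> nat)) by rewrite -!val_eqE.
by case: (tpermP a b p) pa pb => [->|->|/eqP + /eqP +]; case: (tpermP a b q) qa qb =>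
  [->|->|/eqP + /eqP +]; rewrite -!val_eqE /=; lia.
Qed.

Lemma big_op_three_term (n : nat) (f : fn n) (a b : 'I_n) (x : 'I_n -> rat) :
  b = a.+1 :> nat -> x a = x b ->
  (forall y, f (swapv a b y) = - f y) ->
  big_op f x + big_op f (shiftv a (shiftv b x)) = big_op f (shiftv b x).
Proof.
move=> ab xab hf.
(* With the extra factor for [(b, a)] the value at [x] equals its own negative, since [x] is fixed
   by the swap; expanding that factor gives the three terms. *)
have := idEDops_swapv ((b, a) :: pairs_lt n) x hf.
rewrite -(idEDops_perm _ (pairs_lt_swap ab)).
have -> : swapv a b x = x.
  apply: functional_extensionality => i; rewrite /swapv.
  by case: tpermP => // ->.
rewrite /= /idEDop /Eop /Dop /Eop -/(idEDops _ _) -/(big_op _) => h.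
by rewrite shiftvC -[idEDops _ _]/(big_op f) in h *; lra.
Qed.

(** * The operator product on functions independent of one variable *)

Definition skipv (n : nat) (r : 'I_n.+1) (x : 'I_n.+1 -> rat) : 'I_n -> rat :=
  fun j => x (lift r j).

Definition unlift_pair (n : nat) (r : 'I_n.+1) (pq : 'I_n.+1 * 'I_n.+1)
    : option ('I_n * 'I_n) :=
  if unlift r pq.1 is Some p then
    if unlift r pq.2 is Some q then Some (p, q) else None
  else None.

(* [Delta_r] kills a function independent of [x_r], so a factor [(p, r)] acts as
   the identity; [E_r] fixes it, so a factor [(r, q)] acts as [E_q]. *)
Lemma idEDops_skipv (n : nat) (r : 'I_n.+1) (s : seq ('I_n.+1 * 'I_n.+1))
    (g : fn n) (x : 'I_n.+1 -> rat) :
  idEDops s (fun y => g (skipv r y)) x =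
  idEDops (pmap (unlift_pair r) s) g
    (fun j => x (lift r j) + (count_mem (r, lift r j) s)%:R).
Proof.
have ln j : (lift r j == r) = false by rewrite eq_sym (negPf (neq_lift r j)).
have nl j : (r == lift r j) = false by rewrite eq_sym ln.
elim: s x => [|[p q] s IH] x.
  by rewrite /= /skipv; congr g; apply: functional_extensionality => j; rewrite addr0.
rewrite /= /idEDop /Eop /Dop /Eop !IH /unlift_pair /=.
case: (unliftP r p) => [p'|] ->; case: (unliftP r q) => [q'|] ->.
- rewrite /= /idEDop /Eop /Dop /Eop.
  set h := idEDops _ g.
  by congr (h _ + (h _ - h _)); apply: functional_extensionality => j;
    rewrite /shiftv /= ?(inj_eq (@lift_inj _ r)) xpair_eqE ?nl ?ln ?andbF ?add0n //=;
    do ?[case: ifP => _]; ring.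
- set h := idEDops _ g.
  rewrite /=; set u := h _; set v := h _; set w := h _.
  have -> : v = w.
    rewrite /v /w; congr h; apply: functional_extensionality => j.
    by rewrite /shiftv ?nl ?ln.
  rewrite subrr addr0 /u; congr h; apply: functional_extensionality => j.
  by rewrite xpair_eqE ?nl ?ln.
- set h := idEDops _ g.
  rewrite /=; set u := h _; set v := h _; set w := h _.
  have -> : w = u.
    rewrite /u /w; congr h; apply: functional_extensionality => j.
    by rewrite /shiftv ?nl ?ln.
  rewrite addrC subrK /v; congr h; apply: functional_extensionality => j.
  rewrite /shiftv !xpair_eqE eqxx /= !(inj_eq (@lift_inj _ r)) ?nl ?ln.
  rewrite eq_sym; case: eqP => _ /=; rewrite ?add0n// natrD; ring.
- set h := idEDops _ g.
  rewrite /=; set u := h _; set v := h _; set w := h _.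
  have -> : v = w.
    rewrite /v /w; congr h; apply: functional_extensionality => j.
    by rewrite /shiftv ?nl ?ln.
  rewrite subrr addr0 /u; congr h; apply: functional_extensionality => j.
  by rewrite xpair_eqE eqxx ?nl.
Qed.

Lemma pmap_pairs_lt (n : nat) (r : 'I_n.+1) :
  perm_eq (pmap (unlift_pair r) (pairs_lt n.+1)) (pairs_lt n).
Proof.
pose lp (pq : 'I_n * 'I_n) := (lift r pq.1, lift r pq.2).
have lpE pq : unlift_pair r (lp pq) = Some pq.
  by case: pq => p q; rewrite /unlift_pair !liftK.
have oc : ocancel (unlift_pair r) lp.
  move=> [p q]; rewrite /unlift_pair /oapp /=.
  by case: (unliftP r p) => [p'|] -> //; case: (unliftP r q) => [q'|] ->.
apply: uniq_perm; rewrite ?pairs_lt_uniq ?(pmap_uniq oc) ?pairs_lt_uniq//.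
move=> [p q]; rewrite mem_pmap mem_pairs_lt.
apply/mapP/idP => [[[p1 q1]]|pq].
  rewrite mem_pairs_lt => pq1 /esym h; have := oc (p1, q1); rewrite h /= => -[hp hq].
  by move: pq1; rewrite -hp -hq /= /bump; lia.
exists (lp (p, q)); last by rewrite lpE.
by rewrite mem_pairs_lt /= /bump; lia.
Qed.

Lemma big_op_skipv (n : nat) (r : 'I_n.+1) (g : fn n) (x : 'I_n.+1 -> rat) :
  big_op (fun y => g (skipv r y)) x =
  big_op g (fun j => x (lift r j) + (r <= j)%:R).
Proof.
rewrite -[LHS]/(idEDops _ _ x) idEDops_skipv (idEDops_perm _ (pmap_pairs_lt r)).
congr (big_op g); apply: functional_extensionality => j.
(* The pair [(r, lift r j)] occurs at most once, and does so exactly when [r < lift r j], that is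
   [r <= j]. *)
rewrite count_uniq_mem ?pairs_lt_uniq// mem_pairs_lt /= /bump.
by congr (_ + (nat_of_bool _)%:R); lia.
Qed.

(** * Determinants of binomial coefficients *)

Definition binp (j : nat) : {poly rat} := \prod_(i < j) ('X - i%:R%:P).

(** The binomial coefficient binom(x, j) at a rational [x]; [binp j] is the falling factorial. *)
Definition binq (x : rat) (j : nat) : rat := (binp j).[x] / j`!%:R.

Lemma size_binp (j : nat) : size (binp j) = j.+1.
Proof.
by rewrite /binp -(big_mkord predT (fun i => 'X - i%:R%:P)) size_prod_XsubC size_iota subn0.
Qed.

Lemma binq0 (x : rat) : binq x 0 = 1.
Proof. by rewrite /binq /binp big_ord0 hornerC divr1. Qed.

(** Pascal's rule: splitting off the first factor at [x + 1] and the last at [x] leaves the same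
    [binp j], and (x + 1) - (x - j) = j + 1. *)
Lemma binqS (x : rat) (j : nat) : binq (x + 1) j.+1 - binq x j.+1 = binq x j.
Proof.
have fj : (j`!%:R != 0 :> rat) by rewrite pnatr_eq0 -lt0n fact_gt0.
have sj : (j.+1%:R != 0 :> rat) by rewrite pnatr_eq0.
rewrite /binq {1}/binp big_ord_recl hornerM !hornerXsubC.
have -> : (\prod_(i < j) ('X - (bump 0 i)%:R%:P)).[x + 1] = (binp j).[x].
  rewrite !horner_prod; apply: eq_bigr => i _.
  by rewrite !hornerXsubC /bump /= natrD; ring.
rewrite {2}/binp big_ord_recr hornerM !hornerXsubC /= -/(binp j) factS natrM.
by rewrite -natr1 in sj *; field; rewrite fj.
Qed.

(** The matrix is a Vandermonde matrix times a triangular matrix of coefficients, whose diagonal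
    entries are 1/j! because [binp j] is monic. *)
Lemma vdm_quotE (n : nat) (x : 'I_n -> rat) :
  vdm_quot x = \det (\matrix_(i < n, j < n) binq (x i) j).
Proof.
have -> : \matrix_(i < n, j < n) binq (x i) j =
   (Vandermonde n (\row_i x i))^T *m
   (\matrix_(j < n, k < n) ((binp j)`_k / j`!%:R))^T.
  apply/matrixP => i j; rewrite !mxE /binq.
  rewrite (horner_coef_wide (n := n)) ?size_binp// mulr_suml.
  by apply: eq_bigr => k _; rewrite !mxE; ring.
rewrite det_mulmx !det_tr det_Vandermonde det_trig; last first.
  apply/is_trig_mxP => i j ij; rewrite mxE nth_default ?mul0r//.
  by rewrite size_binp.
rewrite /vdm_quot.
under eq_bigr => i _ do rewrite big_split /=.
rewrite big_split /=; congr (_ * _).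
  by apply: eq_bigr => i _; apply: eq_bigr => j _; rewrite !mxE.
(* For fixed [j] the denominators [j - i] with [i < j] multiply to j!. *)
rewrite (exchange_big_dep predT) //=; apply: eq_bigr => j _.
rewrite mxE.
have /monicP : binp j \is monic by exact: monic_prod_XsubC.
rewrite /lead_coef size_binp /= => ->; rewrite mul1r.
rewrite prodfV -natr_prod; congr (_%:R^-1).
rewrite (big_ord_narrow (ltnW (ltn_ord j))).
rewrite fact_prod big_add1 big_mkord (reindex_inj rev_ord_inj) /=.
by apply: eq_bigr => i _; have := ltn_ord i; lia.
Qed.

(** An antidifference of [vdm_quot] in all variables at once: each difference lowers the column
    index in one row. *)
Definition vdm_up (n : nat) : fn n :=
  fun x => \det (\matrix_(i < n, j < n) binq (x i) j.+1).

Lemma vdm_quot_expand (n : nat) :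
  @vdm_quot n.+1 = fun x => \sum_(r < n.+1) (-1) ^+ r * vdm_up (skipv r x).
Proof.
apply: functional_extensionality => x.
rewrite vdm_quotE (expand_det_col _ ord0); apply: eq_bigr => r _.
rewrite mxE binq0 mul1r /cofactor addn0; congr (_ * \det _).
by apply/matrixP => i j; rewrite !mxE.
Qed.

Lemma vdm_up_swapv (n : nat) (a b : 'I_n) (x : 'I_n -> rat) :
  a != b -> vdm_up (swapv a b x) = - vdm_up x.
Proof.
move=> ab; rewrite /vdm_up.
have -> : \matrix_(i < n, j < n) binq (swapv a b x i) j.+1 =
    row_perm (tperm a b) (\matrix_(i < n, j < n) binq (x i) j.+1).
  by apply/matrixP => i j; rewrite !mxE.
by rewrite row_permE det_mulmx det_perm odd_tperm ab mulN1r.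
Qed.

(** Row [r] alone depends on [x r], so [Dop r] acts on that row only; the summand [i \notin s] marks
    the rows not yet differenced. *)
Lemma Dop_vdm_up (n : nat) (s : seq 'I_n) : uniq s ->
  foldr (@Dop n) (@vdm_up n) s =
  fun x => \det (\matrix_(i < n, j < n) binq (x i) (j + (i \notin s))).
Proof.
elim: s => [_|r s IH /= /andP[rs us]].
  apply: functional_extensionality => x; congr (\det _).
  by apply/matrixP => i j; rewrite !mxE addn1.
rewrite IH//; apply: functional_extensionality => x; rewrite /Dop /Eop.
set A := \matrix_(_, _) _; set B := \matrix_(_, _) _; set C := \matrix_(_, _) _.
(* The three matrices agree outside row [r], where Pascal's rule writes the row of [A] as the sum of
   those of [B] and [C]. *)
suff -> : \det A = 1 * \det B + 1 * \det C by ring.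
apply: (determinant_multilinear (i0 := r)); apply/matrixP => i j.
- rewrite !mxE /shiftv eqxx rs inE eqxx /= addn1 addn0 -(binqS (x r) j); ring.
- by rewrite !mxE /shiftv eq_sym (negPf (neq_lift _ _)).
- by rewrite !mxE /shiftv inE eq_sym (negPf (neq_lift _ _)).
Qed.

Lemma Dop_vdm_up_all (n : nat) : foldr (@Dop n) (@vdm_up n) (enum 'I_n) = @vdm_quot n.
Proof.
rewrite Dop_vdm_up ?enum_uniq//; apply: functional_extensionality => x.
rewrite vdm_quotE; congr (\det _).
by apply/matrixP => i j; rewrite !mxE mem_enum addn0.
Qed.

(** * Integer lists as argument vectors *)

Definition vec_of (n : nat) (l : seq int) : 'I_n -> rat := fun i => (nth 0 l i)%:~R.

Definition consv (n : nat) (a : rat) (x : 'I_n -> rat) : 'I_n.+1 -> rat :=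
  fun i => if unlift ord0 i is Some j then x j else a.

Lemma vec_of_cons (n : nat) (a : int) (l : seq int) :
  @vec_of n.+1 (a :: l) = consv a%:~R (vec_of l).
Proof.
apply: functional_extensionality => i; rewrite /vec_of /consv.
by case: (unliftP ord0 i) => [j|] ->.
Qed.

Lemma foldr_Dop_consv (n : nat) (f : fn n.+1) (s : seq 'I_n) (a : rat) (x : 'I_n -> rat) :
  foldr (@Dop n.+1) f [seq lift ord0 i | i <- s] (consv a x) =
  foldr (@Dop n) (fun y => f (consv a y)) s x.
Proof.
elim: s x => //= r s IH x; rewrite /Dop /Eop -!IH.
suff -> : shiftv (lift ord0 r) (consv a x) = consv a (shiftv r x) by [].
apply: functional_extensionality => i; rewrite /shiftv /consv.
by case: (unliftP ord0 i) => [j|] ->; rewrite ?(inj_eq (@lift_inj _ ord0)).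
Qed.

Lemma delta_allE (n : nat) (f : fn n) (l : seq int) : size l = n ->
  delta_all (fun m => f (vec_of m)) l = foldr (@Dop n) f (enum 'I_n) (vec_of l).
Proof.
elim: n f l => [|n IH] f [|a l]// => [_|[sz]].
  by rewrite enum_ord0.
rewrite enum_ordSl vec_of_cons /= /Dop /Eop.
have -> : shiftv ord0 (consv a%:~R (vec_of l)) = consv (a + 1)%:~R (@vec_of n l).
  apply: functional_extensionality => i; rewrite /shiftv /consv.
  by case: (unliftP ord0 i) => [j|] -> //=; rewrite rmorphD.
rewrite !foldr_Dop_consv -!IH//.
have H b : (fun m => f (vec_of (b :: m))) = fun m => f (consv b%:~R (vec_of m)).
  by apply: functional_extensionality => m; rewrite vec_of_cons.
by rewrite !H.
Qed.

Lemma big_op_Dops (n : nat) (f : fn n) (s : seq 'I_n) :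
  big_op (foldr (@Dop n) f s) = foldr (@Dop n) (big_op f) s.
Proof. by elim: s => //= r s <-; exact: idEDops_Dop. Qed.

(** * The antidifference [B] and the final count *)

Definition antidiff (n : nat) (l : seq int) : rat := big_op (@vdm_up n) (vec_of l).

Lemma delta_all_antidiff (n : nat) (l : seq int) : size l = n ->
  delta_all (antidiff n) l = big_op (@vdm_quot n) (vec_of l).
Proof. by move=> sz; rewrite delta_allE// -big_op_Dops Dop_vdm_up_all. Qed.

Lemma shiftv_vec_of (n : nat) (i : 'I_n) (u : seq int) (y : int) (v : seq int) :
  i = size u :> nat ->
  shiftv i (vec_of (u ++ y :: v)) = vec_of (u ++ y + 1 :: v).
Proof.
move=> iu; apply: functional_extensionality => j; rewrite /shiftv /vec_of !nth_cat.
rewrite -val_eqE /= -iu; case: (ltngtP j i) => // ij.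
  by have -> : (j - i = (j - i).-1.+1)%N by lia.
by rewrite ij subnn /= rmorphD.
Qed.

Lemma antidiff_three_term (n : nat) : three_term n (antidiff n).
Proof.
move=> u y v; rewrite size_cat /= => sz.
have ha : (size u < n)%N by lia.
have hb : ((size u).+1 < n)%N by lia.
pose a := Ordinal ha; pose b := Ordinal hb.
have hsa c d := @shiftv_vec_of n a u c d erefl.
have hsb c d : shiftv b (vec_of (u ++ [:: c, d & v])) = vec_of (u ++ [:: c, d + 1 & v]).
  by rewrite -(cat_rcons c u (d :: v)) -(cat_rcons c u (d + 1 :: v)) shiftv_vec_of// size_rcons.
rewrite /antidiff -hsa -!hsb; apply: (big_op_three_term (a := a) (b := b)) => //.
  by rewrite /vec_of !nth_cat /= ltnn ltnNge leqnSn subnn subSnn.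
by move=> x; apply: vdm_up_swapv; rewrite -val_eqE /=; lia.
Qed.

(** The sums agree term by term: the shift [r <= j] of [big_op_skipv] is the increment of the
    entries after the omitted one. *)
Lemma altsum_antidiff (n : nat) (k : seq int) : size k = n.+1 ->
  altsum k (antidiff n) = big_op (@vdm_quot n.+1) (vec_of k).
Proof.
move=> sz; rewrite vdm_quot_expand -[RHS]/(idEDops _ _ _) idEDops_sum altsumE sz.
apply: eq_bigr => r _; rewrite -[idEDops _ _]/(big_op _) big_op_skipv; congr (_ * big_op _ _).
apply: functional_extensionality => j; rewrite /vec_of nth_cat size_take sz ltn_ord.
rewrite -(rmorph_nat (intmul 1)) -rmorphD /= /bump.
case: (ltnP j r) => jr; first by rewrite nth_take// add0n addr0.
have := ltn_ord j => jn.
rewrite (nth_map 0) ?size_drop ?sz; last by lia.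
rewrite nth_drop; congr (nth 0 k _ + _)%:~R; lia.
Qed.

(** Induction on the number of rows: the count is the sum over the rows above [k] of the formula
    with one variable fewer, which [sum_rows] and [altsum_antidiff] evaluate. *)
Lemma size_triangles (n : nat) (k : seq int) :
  size k = n -> sorted <%R k ->
  (size (triangles n k))%:R = big_op (@vdm_quot n) (vec_of k).
Proof.
elim: n k => [|n IH] k szk srt.
  rewrite /big_op /pairs_lt (_ : enum 'I_0 = [::]); last by rewrite enum_ord0.
  by rewrite /= /vdm_quot big_ord0.
rewrite -altsum_antidiff// /= size_allpairs_dep sumnE big_map natr_sum.
rewrite big_seq (eq_bigr (delta_all (antidiff n))); last first.
  by move=> l /(rows_aboveP l szk srt)[szl sl _]; rewrite delta_all_antidiff// IH.
rewrite -big_seq.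
case: k szk srt => [//|a s] [szs] /= srt; rewrite /rows_above /= sum_rows//.
- by case: s srt {szs} => //= b s /andP[/ltW].
- exact: path_sorted srt.
- by rewrite szs; exact: antidiff_three_term.
Qed.

Theorem theorem1 (n : nat) (k : seq int) :
  (0 < n)%N -> size k = n -> sorted <%R k ->
  exists s : seq (seq (seq int)),
    uniq s /\
    (forall t, t \in s <-> (monotone_triangle n t /\ bottom_row n t = k)) /\
    (size s)%:R = big_op (@vdm_quot n) (fun i : 'I_n => (nth 0 k i)%:~R).
Proof.
move=> _ szk srt; exists (triangles n k); split; first exact: triangles_uniq.
by split=> [t|]; [exact: trianglesP | exact: size_triangles].
Qed.
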